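(* Let $n\ge2$, let $\alpha_i=\langle\mu_{\alpha_i},\eta_{\alpha_i},\nu_{\alpha_i}\rangle$ ($i=1,\dots,n$) be picture fuzzy numbers, let $\omega=(\omega_1,\dots,\omega_n)^{\mathrm T}$ be the weight vector with $\omega_i\in(0,1]$ and $\sum_{i=1}^n\omega_i=1$, let $T$ be a strict t-norm with additive generator $\tau$, and let $\zeta(x)=\tau(1-x)$. Then for all $p,q>0$, $\mathrm{PFINWBM}_T^{p,q}(\alpha_1,\dots,\alpha_n)$ is a picture fuzzy number, and $$\mathrm{PFINWBM}_T^{p,q}(\alpha_1,\dots,\alpha_n)=\Big\langle\tau^{-1}\big(\tfrac1{p+q}\tau(\hat\mu)\big),\ \tau^{-1}\big(\tfrac1{p+q}\tau(\hat\eta+\hat\mu)\big)-\tau^{-1}\big(\tfrac1{p+q}\tau(\hat\mu)\big),\ \zeta^{-1}\big(\tfrac1{p+q}\zeta(\hat\nu)\big)\Big\rangle,$$ where (all sums being over ordered pairs $(i,j)$ with $1\le i,j\le n$, $i\ne j$) $$\hat\mu=\zeta^{-1}\Big(\sum_{i\ne j}\tfrac{\omega_i\omega_j}{1-\omega_i}\,\zeta\big(\tau^{-1}(p\,\tau(\mu_{\alpha_i})+q\,\tau(\mu_{\alpha_j}))\big)\Big),$$ $$\begin{aligned}\hat\eta=\ &\tau^{-1}\Big(\sum_{i\ne j}\tfrac{\omega_i\omega_j}{1-\omega_i}\,\tau\big(\tau^{-1}(p\,\tau(\eta_{\alpha_i}+\mu_{\alpha_i})+q\,\tau(\eta_{\alpha_j}+\mu_{\alpha_j}))-\tau^{-1}(p\,\tau(\mu_{\alpha_i})+q\,\tau(\mu_{\alpha_j}))+\zeta^{-1}(p\,\zeta(\nu_{\alpha_i})+q\,\zeta(\nu_{\alpha_j}))\big)\Big)\\&-\tau^{-1}\Big(\sum_{i\ne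 j}\tfrac{\omega_i\omega_j}{1-\omega_i}\,\tau\big(\zeta^{-1}(p\,\zeta(\nu_{\alpha_i})+q\,\zeta(\nu_{\alpha_j}))\big)\Big),\end{aligned}$$ $$\hat\nu=\tau^{-1}\Big(\sum_{i\ne j}\tfrac{\omega_i\omega_j}{1-\omega_i}\,\tau\big(\zeta^{-1}(p\,\zeta(\nu_{\alpha_i})+q\,\zeta(\nu_{\alpha_j}))\big)\Big).$$
   Context: A picture fuzzy number (PFN) is a triple $\alpha=\langle\mu,\eta,\nu\rangle$ with $\mu,\eta,\nu\in[0,1]$ and $\mu+\eta+\nu\le1$. A t-norm is a commutative, associative map $T:[0,1]^2\to[0,1]$, nondecreasing in each variable, with $T(1,x)=x$. It is strict if it is continuous and $T(x,y)<T(x,z)$ whenever $x>0$ and $y<z$. A strict t-norm has a continuous additive generator: a continuous strictly decreasing bijection $\tau:[0,1]\to[0,+\infty]$ with $\tau(1)=0$, $\tau(0)=+\infty$ and $T(x,y)=\tau^{-1}(\tau(x)+\tau(y))$. Its dual t-conorm is $S(x,y)=1-T(1-x,1-y)=\zeta^{-1}(\zeta(x)+\zeta(y))$, where $\zeta(x)=\tau(1-x)$. Arithmetic in $[0,+\infty]$ is the usual one ($a+\infty=\infty$, $\lambda\cdot\infty=\infty$ for $\lambda>0$). For a strict t-norm $T$, PFNs $\alpha_k=\langle\mu_k,\eta_k,\nu_k\rangle$ ($k=1,2$), $\alpha=\langle\mu,\eta,\nu\rangle$ and $\lambda>0$ define: $\alpha_1\oplus\alpha_2=\langle S(\mu_1,\mu_2),\,T(\eta_1+\nu_1,\eta_2+\nu_2)-T(\nu_1,\nu_2),\,T(\nu_1,\nu_2)\rangle$;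 $\alpha_1\otimes\alpha_2=\langle T(\mu_1,\mu_2),\,T(\eta_1+\mu_1,\eta_2+\mu_2)-T(\mu_1,\mu_2),\,S(\nu_1,\nu_2)\rangle$; $\lambda\cdot\alpha=\langle\zeta^{-1}(\lambda\zeta(\mu)),\,\tau^{-1}(\lambda\tau(\eta+\nu))-\tau^{-1}(\lambda\tau(\nu)),\,\tau^{-1}(\lambda\tau(\nu))\rangle$; $\alpha^\lambda=\langle\tau^{-1}(\lambda\tau(\mu)),\,\tau^{-1}(\lambda\tau(\eta+\mu))-\tau^{-1}(\lambda\tau(\mu)),\,\zeta^{-1}(\lambda\zeta(\nu))\rangle$. These operations send PFNs to PFNs, and $\oplus,\otimes$ are commutative and associative (known facts), so iterated $\bigoplus$ is well defined. For $p,q>0$ the picture fuzzy interactional normalized weighted Bonferroni mean induced by $T$ (with weight vector $\omega$) is $$\mathrm{PFINWBM}_T^{p,q}(\alpha_1,\dots,\alpha_n)=\Big[\bigoplus_{i,j=1,\ i\ne j}^n\tfrac{\omega_i\omega_j}{1-\omega_i}\cdot(\alpha_i^p\otimes\alpha_j^q)\Big]^{\frac1{p+q}}.$$ *)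

(* Defs.v *)
From HB Require Import structures.
From mathcomp Require Import all_boot all_order all_algebra.
From mathcomp Require Import all_classical all_reals all_analysis.

Set Implicit Arguments.
Unset Strict Implicit.
Unset Printing Implicit Defensive.

Import Order.TTheory GRing.Theory Num.Theory.
Import numFieldNormedType.Exports.

Local Open Scope classical_set_scope.
Local Open Scope ring_scope.

(* Functions on [0,1] are total functions on R of which only the restriction
   to `[0, 1] matters. *)

Record tnorm (R : realType) (T : R -> R -> R) : Prop := Tnorm {
  tnorm_itv : {in `[0, 1] &, forall x y, T x y \in `[0, 1]} ;
  tnormC : {in `[0, 1] &, forall x y, T x y = T y x} ;
  tnormA : {in `[0, 1] & &, forall x y z, T x (T y z) = T (T x y) z} ;
  tnorm_lel : {in `[0, 1] & &, forall x y z, x <= y -> T x z <= T y z} ;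
  tnorm_ler : {in `[0, 1] & &, forall x y z, y <= z -> T x y <= T x z} ;
  tnorm1x : {in `[0, 1], forall x, T 1 x = x}
}.

Record strict_tnorm (R : realType) (T : R -> R -> R) : Prop := StrictTnorm {
  strict_tnorm_tnorm : tnorm T ;
  strict_tnorm_continuous :
    {within `[0, 1] `*` `[0, 1], continuous (fun xy : R * R => T xy.1 xy.2)} ;
  strict_tnorm_lt : {in `[0, 1] & &, forall x y z,
    0 < x -> y < z -> T x y < T x z}
}.

(* The inverse of f restricted to [0,1], defined on f([0,1]) (default value 0
   elsewhere). *)
Definition uinv (R : realType) (f : R -> \bar R) : \bar R -> R :=
  'pinv_(fun=> 0) `[0, 1] f.

Record additive_generator (R : realType) (T : R -> R -> R)
    (tau : R -> \bar R) : Prop := AdditiveGenerator {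
  generator_continuous : {within `[0, 1], continuous tau} ;
  generator_decr : {in `[0, 1] &, forall x y, x < y -> (tau y < tau x)%E} ;
  generator_bij : set_bij `[0, 1] [set y | (0 <= y)%E] tau ;
  generator1 : tau 1 = 0%E ;
  generator0 : tau 0 = +oo%E ;
  generatorE : {in `[0, 1] &, forall x y, T x y = uinv tau (tau x + tau y)%E}
}.

Definition dual_conorm (R : realType) (T : R -> R -> R) (x y : R) : R :=
  1 - T (1 - x) (1 - y).

Definition dual_generator (R : realType) (tau : R -> \bar R) (x : R) : \bar R :=
  tau (1 - x).

Record pftriple (R : realType) := PFTriple {
  pf_mu : R ;
  pf_eta : R ;
  pf_nu : R
}.

Definition is_pfn (R : realType) (a : pftriple R) : Prop :=
  [/\ 0 <= pf_mu a <= 1, 0 <= pf_eta a <= 1, 0 <= pf_nu a <= 1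
    & pf_mu a + pf_eta a + pf_nu a <= 1].

Definition pf_add (R : realType) (T : R -> R -> R) (a b : pftriple R) :
    pftriple R :=
  PFTriple (dual_conorm T (pf_mu a) (pf_mu b))
    (T (pf_eta a + pf_nu a) (pf_eta b + pf_nu b) - T (pf_nu a) (pf_nu b))
    (T (pf_nu a) (pf_nu b)).

Definition pf_mul (R : realType) (T : R -> R -> R) (a b : pftriple R) :
    pftriple R :=
  PFTriple (T (pf_mu a) (pf_mu b))
    (T (pf_eta a + pf_mu a) (pf_eta b + pf_mu b) - T (pf_mu a) (pf_mu b))
    (dual_conorm T (pf_nu a) (pf_nu b)).

Definition pf_scale (R : realType) (tau : R -> \bar R) (l : R)
    (a : pftriple R) : pftriple R :=
  let zeta := dual_generator tau in
  PFTriple (uinv zeta (l%:E * zeta (pf_mu a))%E)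
    (uinv tau (l%:E * tau (pf_eta a + pf_nu a)%R)%E
      - uinv tau (l%:E * tau (pf_nu a))%E)
    (uinv tau (l%:E * tau (pf_nu a))%E).

Definition pf_exp (R : realType) (tau : R -> \bar R) (a : pftriple R)
    (l : R) : pftriple R :=
  let zeta := dual_generator tau in
  PFTriple (uinv tau (l%:E * tau (pf_mu a))%E)
    (uinv tau (l%:E * tau (pf_eta a + pf_mu a)%R)%E
      - uinv tau (l%:E * tau (pf_mu a))%E)
    (uinv zeta (l%:E * zeta (pf_nu a))%E).

(* <0, 0, 1> is the neutral element of pf_add T on picture fuzzy numbers; it
   only serves as the initial value of iterated sums. *)
Definition pf_zero (R : realType) : pftriple R := PFTriple 0 0 1.

(* Additive generators of T agree up to a positive factor, so the value does
   not depend on the choice of the generator tau of T. *)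
Definition PFINWBM (R : realType) (T : R -> R -> R) (tau : R -> \bar R)
    (p q : R) (n : nat) (w : 'I_n -> R) (a : 'I_n -> pftriple R) :
    pftriple R :=
  pf_exp tau
    (\big[pf_add T/pf_zero R]_(ij : 'I_n * 'I_n | ij.1 != ij.2)
       pf_scale tau (w ij.1 * w ij.2 / (1 - w ij.1))
         (pf_mul T (pf_exp tau (a ij.1) p) (pf_exp tau (a ij.2) q)))
    (1 / (p + q)).

(* Main.v *)
(** Put a = tau (1 - mu), b = tau (eta + nu) and c = tau nu.  In the
    coordinates (a, b, c) a picture fuzzy number is a chain
    0 <= a <= b <= c <= +oo, the operation [pf_add] is the componentwise sum,
    and [pf_scale] is the componentwise multiplication by a nonnegative
    scalar.  The operations [pf_mul] and [pf_exp] are conjugate to these two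
    under the exchange of mu and nu, so the iterated sum in the Bonferroni
    mean can be read off coordinatewise. *)
Require Import Defs.
From HB Require Import structures.
From mathcomp Require Import all_boot all_order all_algebra.
From mathcomp Require Import all_classical all_reals all_analysis.
From mathcomp Require Import lra.

Set Implicit Arguments.
Unset Strict Implicit.
Unset Printing Implicit Defensive.

Import Order.TTheory GRing.Theory Num.Theory.

Local Open Scope ring_scope.

(** * Triples and the exchange of mu and nu *)

Lemma pftriple_ext (R : realType) (a b : pftriple R) :
  pf_mu a = pf_mu b -> pf_eta a = pf_eta b -> pf_nu a = pf_nu b -> a = b.
Proof. by case: a b => [? ? ?] [? ? ?] /= -> -> ->. Qed.

Definition pf_swap (R : realType) (a : pftriple R) : pftriple R :=
  PFTriple (pf_nu a) (pf_eta a) (pf_mu a).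

Lemma pf_swap_pfn (R : realType) (a : pftriple R) :
  is_pfn a -> is_pfn (pf_swap a).
Proof. by case=> *; split=> //=; lra. Qed.

Lemma pf_mul_swap (R : realType) (T : R -> R -> R) (a b : pftriple R) :
  pf_mul T a b = pf_swap (pf_add T (pf_swap a) (pf_swap b)).
Proof. by []. Qed.

Lemma pf_exp_swap (R : realType) (tau : R -> \bar R) (a : pftriple R) (l : R) :
  pf_exp tau a l = pf_swap (pf_scale tau l (pf_swap a)).
Proof. by []. Qed.

(** Inverse of the coordinate map. Since b stands for [tau (eta + nu)], eta is a difference;
    [1 - uinv tau a] is the inverse of zeta at a, written so that only the inverse of tau occurs. *)
Definition pf_of_coord (R : realType) (tau : R -> \bar R) (a b c : \bar R) :
    pftriple R :=
  PFTriple (1 - uinv tau a) (uinv tau b - uinv tau c) (uinv tau c).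

(** * The generator and its inverse *)

Section Generator.
Context (R : realType) (T : R -> R -> R) (tau : R -> \bar R).
Hypothesis gen_tau : additive_generator T tau.
Implicit Types (x y l : R) (a b c : \bar R) (f g : pftriple R).

Let itvP x : (x \in `[0, 1]) = (0 <= x <= 1).
Proof. by rewrite in_itv. Qed.

Lemma generator_ge0 x : 0 <= x <= 1 -> (0 <= tau x)%E.
Proof.
by move=> x01; have [+ _ _] := generator_bij gen_tau; apply; rewrite /= itvP.
Qed.

Lemma generator_le x y : 0 <= x <= 1 -> 0 <= y <= 1 -> x <= y ->
  (tau y <= tau x)%E.
Proof.
move=> x01 y01; rewrite le_eqVlt => /predU1P[->//|xy].
by apply: ltW; apply: (generator_decr gen_tau); rewrite ?itvP.
Qed.

Lemma uinv_itv a : (0 <= a)%E -> 0 <= uinv tau a <= 1.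
Proof.
move=> a0; have [_ _ surj] := generator_bij gen_tau.
have := surjpinv_image_sub (dflt := fun=> 0) surj.
by move=> /(_ (uinv tau a)); rewrite /= itvP; apply; exists a.
Qed.

Lemma uinvK a : (0 <= a)%E -> tau (uinv tau a) = a.
Proof.
move=> a0; have [_ _ surj] := generator_bij gen_tau.
by rewrite /uinv (surjpK _ surj)// inE.
Qed.

Lemma generatorK x : 0 <= x <= 1 -> uinv tau (tau x) = x.
Proof.
move=> x01; have [_ inj _] := generator_bij gen_tau.
by rewrite /uinv pinvKV// inE /= itvP.
Qed.

Lemma uinv_le a b : (0 <= a)%E -> (a <= b)%E -> uinv tau b <= uinv tau a.
Proof.
move=> a0 ab; have b0 := le_trans a0 ab.
rewrite leNgt; apply/negP => lt_uv.
have := generator_decr gen_tau; move=> /(_ (uinv tau a) (uinv tau b)).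
rewrite !itvP !uinv_itv// => /(_ isT isT lt_uv).
by rewrite !uinvK// ltNge ab.
Qed.

Lemma uinv_dual a : (0 <= a)%E ->
  uinv (dual_generator tau) a = 1 - uinv tau a.
Proof.
move=> a0; have surj : set_surj `[0, 1]%classic [set y | (0 <= y)%E]
    (dual_generator tau).
  move=> y /= y0; have /andP[? ?] := uinv_itv y0.
  exists (1 - uinv tau y); first by rewrite /= itvP; lra.
  by rewrite /dual_generator subKr uinvK.
have /andP[? ?] : 0 <= uinv (dual_generator tau) a <= 1.
  have := surjpinv_image_sub (dflt := fun=> 0) surj.
  move=> /(_ (uinv (dual_generator tau) a)).
  by rewrite /= itvP; apply; exists a.
(* The equation is turned around so that a can be replaced by the value of zeta at its preimage z,
   which is [tau (1 - z)]; [generatorK] then cancels tau. *)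
have -> : uinv tau a = 1 - uinv (dual_generator tau) a; last by rewrite subKr.
rewrite -[in LHS](surjpK (fun=> 0) surj (x := a)) ?inE//.
by apply: generatorK; rewrite -/(uinv _ _); lra.
Qed.

Lemma uinv0 : uinv tau 0%E = 1.
Proof. by rewrite -(generator1 gen_tau) generatorK// ler01 lexx. Qed.

(** * The operations in coordinates *)

Lemma tnorm_uinv a b : (0 <= a)%E -> (0 <= b)%E ->
  T (uinv tau a) (uinv tau b) = uinv tau (a + b)%E.
Proof.
by move=> a0 b0; rewrite (generatorE gen_tau) ?itvP ?uinv_itv// !uinvK.
Qed.

(** The antitone inverse turns the chain into [uinv tau c <= uinv tau b <= uinv tau a]: the first
    inequality says that eta is nonnegative, the second that mu + eta + nu is at most 1. *)
Lemma pf_of_coord_pfn a b c : (0 <= a)%E -> (a <= b)%E -> (b <= c)%E ->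
  is_pfn (pf_of_coord tau a b c).
Proof.
move=> a0 ab bc; have b0 := le_trans a0 ab; have c0 := le_trans b0 bc.
have := uinv_le a0 ab; have := uinv_le b0 bc.
have := uinv_itv a0; have := uinv_itv b0; have := uinv_itv c0.
move=> /andP[? ?] /andP[? ?] /andP[? ?] ? ?.
by split => /=; lra.
Qed.

(** The arguments of tau in the three coordinates, with the order that the decreasing tau reverses
    into the chain. *)
Lemma pfn_itv f : is_pfn f ->
  [/\ 0 <= 1 - pf_mu f <= 1, 0 <= pf_eta f + pf_nu f <= 1,
      0 <= pf_nu f <= 1, pf_eta f + pf_nu f <= 1 - pf_mu f
    & pf_nu f <= pf_eta f + pf_nu f].
Proof.
by case=> /andP[? ?] /andP[? ?] /andP[? ?] ?; split; lra.
Qed.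

Lemma pf_scaleE l f : 0 <= l -> is_pfn f ->
  pf_scale tau l f = pf_of_coord tau (l%:E * tau (1 - pf_mu f)%R)%E
    (l%:E * tau (pf_eta f + pf_nu f)%R)%E (l%:E * tau (pf_nu f))%E.
Proof.
move=> l0 /pfn_itv[mu01 _ _ _ _].
by rewrite /pf_scale /pf_of_coord uinv_dual// mule_ge0 ?lee_fin ?generator_ge0.
Qed.

Lemma pf_add_of_coord a b c a' b' c' :
  (0 <= a)%E -> (0 <= b)%E -> (0 <= c)%E ->
  (0 <= a')%E -> (0 <= b')%E -> (0 <= c')%E ->
  pf_add T (pf_of_coord tau a b c) (pf_of_coord tau a' b' c') =
  pf_of_coord tau (a + a')%E (b + b')%E (c + c')%E.
Proof.
move=> *; rewrite /pf_add /pf_of_coord /dual_conorm /=.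
(* The differences cancel: 1 - mu and eta + nu become plain values of [uinv tau], on which T adds
   the coordinates. *)
by rewrite !opprB !(addrC 1) !subrK !tnorm_uinv.
Qed.

Lemma pf_coordK f : is_pfn f ->
  pf_of_coord tau (tau (1 - pf_mu f)) (tau (pf_eta f + pf_nu f))
    (tau (pf_nu f)) = f.
Proof.
move=> /pfn_itv[? ? ? _ _]; apply: pftriple_ext => /=.
- by rewrite generatorK// subKr.
- by rewrite !generatorK// addrK.
- by rewrite generatorK.
Qed.

(** * Closure of picture fuzzy numbers under the operations *)

Lemma pf_scale_pfn l f : 0 <= l -> is_pfn f -> is_pfn (pf_scale tau l f).
Proof.
move=> l0 pf; rewrite pf_scaleE//.
have [? ? ? ? ?] := pfn_itv pf.
by apply: pf_of_coord_pfn; rewrite ?mule_ge0 ?lee_wpmul2l ?lee_fin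
  ?generator_ge0 ?generator_le.
Qed.

Lemma pf_add_pfn f g : is_pfn f -> is_pfn g -> is_pfn (pf_add T f g).
Proof.
move=> pf pg; rewrite -(pf_coordK pf) -(pf_coordK pg).
have [? ? ? ? ?] := pfn_itv pf; have [? ? ? ? ?] := pfn_itv pg.
rewrite pf_add_of_coord ?generator_ge0//.
by apply: pf_of_coord_pfn; rewrite ?adde_ge0 ?leeD ?generator_ge0 ?generator_le.
Qed.

Lemma pf_exp_pfn l f : 0 <= l -> is_pfn f -> is_pfn (pf_exp tau f l).
Proof.
move=> l0 pf; rewrite pf_exp_swap.
by apply/pf_swap_pfn/pf_scale_pfn/pf_swap_pfn.
Qed.

Lemma pf_mul_pfn f g : is_pfn f -> is_pfn g -> is_pfn (pf_mul T f g).
Proof.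
move=> pf pg; rewrite pf_mul_swap.
by apply/pf_swap_pfn/pf_add_pfn; apply/pf_swap_pfn.
Qed.

Lemma pf_zero_pfn : is_pfn (pf_zero R).
Proof. by split; rewrite /= ?lexx ?ler01 ?addr0 ?add0r. Qed.

(** The coordinates are those of the swapped triples; the swaps between the product and the two
    powers cancel. *)
Lemma pf_mul_exp p q f g : 0 <= p -> 0 <= q -> is_pfn f -> is_pfn g ->
  pf_mul T (pf_exp tau f p) (pf_exp tau g q) =
  pf_swap (pf_of_coord tau
    (p%:E * tau (1 - pf_nu f)%R + q%:E * tau (1 - pf_nu g)%R)%E
    (p%:E * tau (pf_eta f + pf_mu f)%R + q%:E * tau (pf_eta g + pf_mu g)%R)%E
    (p%:E * tau (pf_mu f) + q%:E * tau (pf_mu g))%E).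
Proof.
move=> p0 q0 /pf_swap_pfn pf /pf_swap_pfn pg.
have [? ? ? _ _] := pfn_itv pf; have [? ? ? _ _] := pfn_itv pg.
rewrite pf_mul_swap !pf_exp_swap !pf_scaleE//; congr pf_swap.
by apply: pf_add_of_coord; rewrite mule_ge0 ?lee_fin ?generator_ge0.
Qed.

Lemma pf_sum_scale (I : Type) (s : seq I) (P : pred I) (l : I -> R)
    (F : I -> pftriple R) :
  (forall i, 0 <= l i) -> (forall i, is_pfn (F i)) ->
  \big[pf_add T/pf_zero R]_(i <- s | P i) pf_scale tau (l i) (F i) =
  pf_of_coord tau
    (\sum_(i <- s | P i) (l i)%:E * tau (1 - pf_mu (F i))%R)%E
    (\sum_(i <- s | P i) (l i)%:E * tau (pf_eta (F i) + pf_nu (F i))%R)%E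
    (\sum_(i <- s | P i) (l i)%:E * tau (pf_nu (F i)))%E.
Proof.
move=> l0 pF; elim: s => [|i s IHs].
  (* Empty sums are 0 and [uinv tau 0] is 1, so coordinates (0, 0, 0) give [pf_zero]. *)
  by rewrite !big_nil /pf_of_coord uinv0 subrr.
rewrite !big_cons; case: ifP => // _.
(* Covers the side conditions of [pf_add_of_coord] for all three coordinates at once, h being the
   argument of tau. *)
have ge0 (h : pftriple R -> R) : (forall f, is_pfn f -> 0 <= h f <= 1) ->
    forall j, (0 <= (l j)%:E * tau (h (F j)))%E.
  by move=> h01 j; rewrite mule_ge0 ?lee_fin ?generator_ge0 ?h01.
rewrite IHs pf_scaleE// pf_add_of_coord//.
all: do ?[apply: sume_ge0 => j _].
all: by [apply: (ge0 (fun f => 1 - pf_mu f)) => f /pfn_itv[]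
  | apply: (ge0 (fun f => pf_eta f + pf_nu f)) => f /pfn_itv[]
  | apply: (ge0 (@pf_nu R)) => f /pfn_itv[]].
Qed.

End Generator.

(** * The Bonferroni mean *)

Theorem theoremV2 (R : realType) (n : nat) (hn : (2 <= n)%N)
    (alpha : 'I_n -> pftriple R) (halpha : forall i, is_pfn (alpha i))
    (omega : 'I_n -> R) (homega : forall i, 0 < omega i <= 1)
    (homega1 : \sum_(i < n) omega i = 1)
    (T : R -> R -> R) (hT : strict_tnorm T)
    (tau : R -> \bar R) (htau : additive_generator T tau)
    (p q : R) (hp : 0 < p) (hq : 0 < q) :
  let zeta := dual_generator tau in
  let taui := uinv tau in
  let zetai := uinv zeta in
  let mu i := pf_mu (alpha i) in
  let eta i := pf_eta (alpha i) in
  let nu i := pf_nu (alpha i) in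
  let c i j := (omega i * omega j / (1 - omega i))%:E in
  let r := (1 / (p + q))%:E in
  let mu_hat :=
    zetai (\sum_(ij : 'I_n * 'I_n | ij.1 != ij.2)
      c ij.1 ij.2 *
        zeta (taui (p%:E * tau (mu ij.1) + q%:E * tau (mu ij.2))))%E in
  let nu_hat :=
    taui (\sum_(ij : 'I_n * 'I_n | ij.1 != ij.2)
      c ij.1 ij.2 *
        tau (zetai (p%:E * zeta (nu ij.1) + q%:E * zeta (nu ij.2))))%E in
  let eta_hat :=
    taui (\sum_(ij : 'I_n * 'I_n | ij.1 != ij.2)
      c ij.1 ij.2 *
        tau (taui (p%:E * tau (eta ij.1 + mu ij.1)%R
                   + q%:E * tau (eta ij.2 + mu ij.2)%R)%E
             - taui (p%:E * tau (mu ij.1) + q%:E * tau (mu ij.2))%E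
             + zetai (p%:E * zeta (nu ij.1) + q%:E * zeta (nu ij.2))%E)%R)%E
    - taui (\sum_(ij : 'I_n * 'I_n | ij.1 != ij.2)
      c ij.1 ij.2 *
        tau (zetai (p%:E * zeta (nu ij.1) + q%:E * zeta (nu ij.2))))%E in
  is_pfn (PFINWBM T tau p q omega alpha) /\
  PFINWBM T tau p q omega alpha =
    PFTriple (taui (r * tau mu_hat)%E)
      (taui (r * tau (eta_hat + mu_hat)%R)%E - taui (r * tau mu_hat)%E)
      (zetai (r * zeta nu_hat)%E).
Proof.
move=> zeta taui zetai mu eta nu c r mu_hat nu_hat eta_hat.
(* This covers [omega i = 1] too, where the quotient by 0 is 0. *)
have w0 i j : 0 <= omega i * omega j / (1 - omega i).
  have /andP[i0 i1] := homega i; have /andP[j0 _] := homega j.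
  by rewrite divr_ge0 ?subr_ge0// mulr_ge0// ltW.
pose F (ij : 'I_n * 'I_n) :=
  pf_mul T (pf_exp tau (alpha ij.1) p) (pf_exp tau (alpha ij.2) q).
have pF ij : is_pfn (F ij).
  by apply: (pf_mul_pfn htau); apply: (pf_exp_pfn htau) => //; exact: ltW.
pose S := \big[pf_add T/pf_zero R]_(ij : 'I_n * 'I_n | ij.1 != ij.2)
  pf_scale tau (omega ij.1 * omega ij.2 / (1 - omega ij.1)) (F ij).
have pS : is_pfn S.
  apply: big_ind => [||ij _]; first exact: pf_zero_pfn.
    exact: (pf_add_pfn htau).
  exact: (pf_scale_pfn htau).
have r0 : 0 <= 1 / (p + q) by rewrite divr_ge0// addr_ge0// ltW.
split; first exact: (pf_exp_pfn htau).
(* The outer power of this triple unfolds to the claimed right-hand side, so only the inner sum has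
   to be identified. *)
suff SE : S = PFTriple mu_hat eta_hat nu_hat.
  by rewrite /PFINWBM -/S SE.
have sum_ge0 (G : 'I_n * 'I_n -> \bar R) : (forall ij, (0 <= G ij)%E) ->
    (0 <= \sum_(ij : 'I_n * 'I_n | ij.1 != ij.2) c ij.1 ij.2 * G ij)%E.
  by move=> G0; apply: sume_ge0 => ij _; rewrite mule_ge0// lee_fin.
(* After [pf_mul_exp] only the last component differs, by the passage from [1 - taui] to [zetai]. *)
have FE ij : F ij = PFTriple
    (taui (p%:E * tau (mu ij.1) + q%:E * tau (mu ij.2))%E)
    (taui (p%:E * tau (eta ij.1 + mu ij.1)%R
           + q%:E * tau (eta ij.2 + mu ij.2)%R)%E
      - taui (p%:E * tau (mu ij.1) + q%:E * tau (mu ij.2))%E)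
    (zetai (p%:E * zeta (nu ij.1) + q%:E * zeta (nu ij.2))%E).
  rewrite /F (pf_mul_exp htau) ?ltW// /zetai (uinv_dual htau)//.
  have nu1 k : (0 <= tau (1 - nu k)%R)%E.
    have [_ _ /andP[? ?] _] := halpha k.
    by apply: (generator_ge0 htau); rewrite /nu; lra.
  apply: adde_ge0; apply: mule_ge0;
    by rewrite ?(nu1, lee_fin) ?(ltW hp, ltW hq).
rewrite /S (pf_sum_scale htau)//; clearbody F.
(* The coordinates give the first component as 1 minus a value of [taui], whereas [mu_hat] uses
   [zetai]. *)
have zsum : zetai (\sum_(ij : 'I_n * 'I_n | ij.1 != ij.2)
      c ij.1 ij.2 * zeta (pf_mu (F ij)))%E =
    1 - taui (\sum_(ij : 'I_n * 'I_n | ij.1 != ij.2)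
      c ij.1 ij.2 * zeta (pf_mu (F ij)))%E.
  apply: (uinv_dual htau); apply: sum_ge0 => ij.
  by apply: (generator_ge0 htau); have [] := pfn_itv (pF ij).
apply: pftriple_ext => /=.
- rewrite -[LHS]zsum; congr (zetai _).
  by apply: eq_bigr => ij _; rewrite FE.
(* By [FE], eta + nu of [F ij] is the three-term argument of tau in [eta_hat]. *)
- by congr (taui _ - taui _); apply: eq_bigr => ij _; rewrite FE.
- by congr (taui _); apply: eq_bigr => ij _; rewrite FE.
Qed.
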